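(* Suppose that $(G,Z,\delta)$ is a new setup. Set $R=\mathrm{Rad}\,\delta$ and $N=G'R$. Then $\delta$ is well-defined as a mapping $\delta:G/R\times G/R\to Z$, and the following hold: $Z\le R\le N\unlhd G$, $Z\le Z(G)$, $R\unlhd G$, $G'\le N$, and $N/R\le Z(G/R)$.
   Context: Conventions: $x^y=y^{-1}xy$, $[x,y]=x^{-1}y^{-1}xy$; $G'$ is the derived subgroup, $Z(G)$ the center. A new setup $(G,Z,\delta)$ consists of a group $G$, a subgroup $Z\le Z(G)$ and a mapping $\delta:G/Z\times G/Z\to Z$ (written $\delta(x,y)$ for $\delta(xZ,yZ)$, and also regarded as a mapping $G\times G\to Z$) such that: $\delta(x,x)=1$ for every $x\in G$; $\delta(x,y)=\delta(y,x)^{-1}$ for every $x,y\in G$; $\delta(xy,z)=\delta(x,z)\delta(y,z)$ whenever $x,y,z\in G$ and $\{x,y,z\}\cap G'\neq\emptyset$; $z^{yx}\delta([z,y],x)=z^{xy}\delta([z,x],y)$ for every $x,y,z\in G$. $\mathrm{Rad}_1\delta=\{t\in G: \delta(tx,y)=\delta(xt,y)=\delta(x,ty)=\delta(x,yt)=\delta(x,y)\text{ for all }x,y\in G\}$ (a subgroup of $G$), and $\mathrm{Rad}\,\delta$ is the largest normal subgroup of $G$ contained in $\mathrm{Rad}_1\delta$. *)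

(* Defs.v *)
From HB Require Import structures.
From mathcomp Require Import all_boot.
From mathcomp Require Import boolp classical_sets.
Set Implicit Arguments.
Unset Strict Implicit.
Unset Printing Implicit Defensive.
Local Open Scope classical_set_scope.
Local Open Scope quotient_scope.
Local Open Scope group_scope.

(* Groups are arbitrary, possibly infinite, [groupType]s and subsets are
   Prop-valued [set]s.  The library conventions are
   x ^ y = y^-1 * (x * y) and [~ x, y] = x^-1 * x ^ y. *)

Section Subgroups.
Variable G : groupType.
Implicit Types (A H K : set G) (x y : G).

Definition is_subgroup H : Prop :=
  [/\ H 1, (forall x y, H x -> H y -> H (x * y)) & (forall x, H x -> H x^-1)].

Definition subgroup_le H K : Prop := is_subgroup H /\ H `<=` K.

Definition is_normal H : Prop :=
  is_subgroup H /\ forall x y, H x -> H (x ^ y).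

Definition center : set G := [set z | forall x, commute z x].

Definition derived : set G :=
  smallest is_subgroup [set [~ x, y] | x in [set: G] & y in [set: G]].

Definition mul_set A B : set G := [set x * y | x in A & y in B].

Record normalSubgroup := NormalSubgroup {
  normal_set :> set G;
  normal_setP : is_normal normal_set }.

Record centralSubgroup := CentralSubgroup {
  central_set : set G;
  central_setP : subgroup_le central_set center }.

Lemma central_is_normal (Z : centralSubgroup) : is_normal (central_set Z).
Proof.
case: Z => Z [sZ cZ] /=; split=> // x y Zx.
by rewrite /conjg (cZ _ Zx y) mulKg.
Qed.

Definition central_normal (Z : centralSubgroup) : normalSubgroup :=
  NormalSubgroup (central_is_normal Z).

End Subgroups.

Arguments center : clear implicits.
Arguments derived : clear implicits.
Coercion central_normal : centralSubgroup >-> normalSubgroup.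

Section Quotient.
Variables (G : groupType) (H : normalSubgroup G).
Implicit Types x y : G.

Definition coset_rel : rel G := fun x y => `[< normal_set H (x^-1 * y) >].

Lemma coset_rel_equiv : equiv_class_of coset_rel.
Proof.
have [[H1 HM HV] _] := normal_setP H.
have sym x y : coset_rel x y -> coset_rel y x.
  by move=> /asboolP/HV xy; apply/asboolP; rewrite invgM invgK in xy.
split=> [x|x y|y x z xy yz].
- by apply/asboolP; rewrite mulVg.
- by apply/idP/idP; apply: sym.
- apply/asboolP; move/asboolP: yz; move/asboolP: xy => xy /(HM _ _ xy).
  by rewrite mulgA mulgK.
Qed.

Canonical coset_equiv := EquivRelPack coset_rel_equiv.

(* The group G/H of cosets xH. *)
Definition quotient := {eq_quot coset_rel}.
HB.instance Definition _ := Choice.on quotient.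
HB.instance Definition _ := EqQuotient.on quotient.

Definition coset x : quotient := \pi_quotient x.

Lemma coset_eqP x y : coset x = coset y <-> normal_set H (x^-1 * y).
Proof.
split=> [/eqquotP/asboolP //|Hxy].
by apply/eqquotP/asboolP.
Qed.

Lemma coset_repr (a : quotient) : coset (repr a) = a.
Proof. exact: reprK. Qed.

Lemma coset_reprV x : normal_set H ((repr (coset x))^-1 * x).
Proof. by apply/coset_eqP; rewrite coset_repr. Qed.

Definition quotient_mul (a b : quotient) : quotient := coset (repr a * repr b).
Definition quotient_inv (a : quotient) : quotient := coset (repr a)^-1.

Lemma quotient_mulE x y : quotient_mul (coset x) (coset y) = coset (x * y).
Proof.
have [[_ HM _] HJ] := normal_setP H.
apply/coset_eqP; set a := repr _; set b := repr _.
rewrite invgM (_ : _ * _ = (a^-1 * x) ^ b * (b^-1 * y)).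
  by apply: HM; [apply: HJ|]; apply: coset_reprV.
by rewrite /conjg !mulgA mulgK.
Qed.

Lemma quotient_invE x : quotient_inv (coset x) = coset x^-1.
Proof.
have [[_ _ HV] HJ] := normal_setP H.
apply/coset_eqP; set a := repr _; rewrite invgK.
rewrite (_ : _ * _ = ((a^-1 * x)^-1) ^ a^-1).
  by apply/HJ/HV/coset_reprV.
by rewrite /conjg invgM !invgK !mulgA mulgK.
Qed.

Fact quotient_mulA : associative quotient_mul.
Proof.
move=> a b c; rewrite -(coset_repr a) -(coset_repr b) -(coset_repr c).
by rewrite !quotient_mulE mulgA.
Qed.

Fact quotient_mul1 : left_id (coset 1) quotient_mul.
Proof. by move=> a; rewrite -(coset_repr a) quotient_mulE mul1g. Qed.

Fact quotient_1mul : right_id (coset 1) quotient_mul.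
Proof. by move=> a; rewrite -(coset_repr a) quotient_mulE mulg1. Qed.

Fact quotient_mulV : left_inverse (coset 1) quotient_inv quotient_mul.
Proof.
by move=> a; rewrite -(coset_repr a) quotient_invE quotient_mulE mulVg.
Qed.

Fact quotient_Vmul : right_inverse (coset 1) quotient_inv quotient_mul.
Proof.
by move=> a; rewrite -(coset_repr a) quotient_invE quotient_mulE mulgV.
Qed.

HB.instance Definition _ := isGroup.Build quotient
  quotient_mulA quotient_mul1 quotient_1mul quotient_mulV quotient_Vmul.

Lemma cosetM x y : coset (x * y) = coset x * coset y.
Proof. by rewrite -quotient_mulE. Qed.

End Quotient.

Section Setup.
Variables (G : groupType) (Z : centralSubgroup G).
Variable delta : quotient Z -> quotient Z -> Z.

(* delta regarded as a mapping G x G -> Z *)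
Definition lift_delta (x y : G) : Z := delta (coset Z x) (coset Z y).

Local Notation d := lift_delta.

Record is_new_setup : Prop := IsNewSetup {
  new_setup_diag : forall x, val (d x x) = 1;
  new_setup_anti : forall x y, val (d x y) = (val (d y x))^-1;
  new_setup_mul : forall x y z : G,
    [set x; y; z] `&` derived G !=set0 ->
    val (d (x * y) z) = val (d x z) * val (d y z);
  new_setup_conj : forall x y z : G,
    z ^ (y * x) * val (d [~ z, y] x) = z ^ (x * y) * val (d [~ z, x] y) }.

Definition Rad1 : set G :=
  [set t | forall x y, [/\ d (t * x) y = d x y, d (x * t) y = d x y,
                           d x (t * y) = d x y & d x (y * t) = d x y]].

(* The largest normal subgroup of G contained in Rad1; see Rad_is_normal,
   Rad_sub and Rad_max. *)
Definition Rad_set : set G :=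
  \bigcup_(K in [set K : set G | is_normal K /\ K `<=` Rad1]) K.

Lemma Rad1_is_subgroup : is_subgroup Rad1.
Proof.
split=> [x y|s t Hs Ht x y|t Ht x y].
- by rewrite !mul1g !mulg1.
- split.
  + by rewrite -mulgA; case: (Hs (t * x) y) => -> *; case: (Ht x y).
  + by rewrite mulgA; case: (Ht (x * s) y) => _ -> *; case: (Hs x y).
  + by rewrite -mulgA; case: (Hs x (t * y)) => _ _ -> *; case: (Ht x y).
  + by rewrite mulgA; case: (Ht x (y * s)) => _ _ _ ->; case: (Hs x y).
- split.
  + by case: (Ht (t^-1 * x) y) => <- *; rewrite mulVKg.
  + by case: (Ht (x * t^-1) y) => _ <- *; rewrite mulgVK.
  + by case: (Ht x (t^-1 * y)) => _ _ <- *; rewrite mulVKg.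
  + by case: (Ht x (y * t^-1)) => _ _ _ <-; rewrite mulgVK.
Qed.

Lemma Rad_sub : Rad_set `<=` Rad1.
Proof. by move=> t [K [_ KR] Kt]; apply: KR. Qed.

Lemma Rad_max (K : set G) : is_normal K -> K `<=` Rad1 -> K `<=` Rad_set.
Proof. by move=> nK KR t Kt; exists K. Qed.

Lemma Rad_is_normal : is_normal Rad_set.
Proof.
have [R1 RM RV] := Rad1_is_subgroup.
pose core : set G := [set t | forall x, Rad1 (t ^ x)].
have nC : is_normal core.
  split; last by move=> x y Cx z; rewrite -conjgM; apply: Cx.
  split=> [x|x y Cx Cy z|x Cx z]; first by rewrite conj1g.
  - by rewrite conjMg; apply: RM.
  - by rewrite conjVg; apply: RV.
have CR : core `<=` Rad1 by move=> t /(_ 1); rewrite conjg1.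
suff -> : Rad_set = core by [].
apply/seteqP; split; last exact: Rad_max.
by move=> t [K [[_ KJ] KR] Kt] x; apply/KR/KJ.
Qed.

Definition Rad : normalSubgroup G := NormalSubgroup Rad_is_normal.

End Setup.

(* Main.v *)
Require Import Defs.
From mathcomp Require Import all_boot.
From mathcomp Require Import boolp classical_sets.
Local Open Scope classical_set_scope.
Local Open Scope group_scope.

(** The heart of the matter is that [G', G] <= Z <= R.  Since delta takes
    values in Z, the last setup axiom says that z^(yx) and z^(xy) agree modulo
    Z for all x, y and z; hence every commutator of G is central modulo Z
    (lemma [commutator_central_mod]).  The elements that are central modulo Z
    form a subgroup, so it contains G' ([derived_central_mod]), and G/Z has
    nilpotency class at most 2.  Because delta is defined on G/Z,
    factors in Z do not affect its values, so Z lies in Rad_1 and, being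
    normal, in R ([central_sub_Rad]).  Thus G' is central modulo R, and so is
    N = G'R, whose image in G/R is that of G'.  That delta factors through G/R
    is the definition of Rad_1 together with R <= Rad_1. *)

(** * Subgroups of an arbitrary group *)

Lemma derived_min (G : groupType) (H : set G) :
  is_subgroup H -> (forall x y, H [~ x, y]) -> derived G `<=` H.
Proof. by move=> sH HR; apply: smallest_sub => // _ [x _ [y _ <-]]. Qed.

Lemma derived_is_subgroup (G : groupType) : is_subgroup (derived G).
Proof.
split=> [H [[H1 _ _] _] //|x y Dx Dy H|x Dx H] HR; have [[_ HM HV] _] := HR.
- by apply: HM; [apply: Dx|apply: Dy].
- by apply: HV; apply: Dx.
Qed.

Lemma derived_is_normal (G : groupType) : is_normal (derived G).
Proof.
have [D1 DM DV] := derived_is_subgroup G.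
split=> // x y Dx; move: x Dx y; apply: derived_min => [|x y g].
  split=> [g|x y Dx Dy g|x Dx g]; rewrite ?conj1g ?conjMg ?conjVg //.
  - exact: DM.
  - exact: DV.
by rewrite conjRg; apply: sub_gen_smallest; exists (x ^ g) => //; exists (y ^ g).
Qed.

Lemma mul_set_is_normal (G : groupType) (A B : set G) :
  is_normal A -> is_normal B -> is_normal (mul_set A B).
Proof.
move=> [[A1 AM AV] AJ] [[B1 BM BV] BJ].
split; first split.
- by exists 1 => //; exists 1 => //; rewrite mulg1.
- move=> _ _ [a Aa [b Bb <-]] [a' Aa' [b' Bb' <-]].
  exists (a * a'); first exact: AM.
  exists (b ^ a' * b'); first by apply: BM; first apply: BJ.
  by rewrite /conjg !mulgA mulgK.
- move=> _ [a Aa [b Bb <-]].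
  exists a^-1; first exact: AV.
  exists ((b^-1) ^ a^-1); first exact/BJ/BV.
  by rewrite /conjg invgK invgM mulKg.
- move=> _ g [a Aa [b Bb <-]].
  by exists (a ^ g); [exact: AJ|exists (b ^ g); [exact: BJ|rewrite conjMg]].
Qed.

Lemma sub_mul_setl (G : groupType) (A B : set G) :
  is_subgroup B -> A `<=` mul_set A B.
Proof. by move=> [B1 _ _] a Aa; exists a => //; exists 1; rewrite ?mulg1. Qed.

Lemma sub_mul_setr (G : groupType) (A B : set G) :
  is_subgroup A -> B `<=` mul_set A B.
Proof. by move=> [A1 _ _] b Bb; exists 1 => //; exists b; rewrite ?mul1g. Qed.

Lemma center_is_subgroup (G : groupType) : is_subgroup (center G).
Proof.
split=> [x|x y Cx Cy z|x Cx z]; apply: commute_sym.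
- exact: commute1.
- by apply: commuteM; apply: commute_sym.
- by apply: commuteV; apply: commute_sym.
Qed.

(** * Cosets *)

Lemma coset1 (G : groupType) (H : normalSubgroup G) : coset H 1 = 1.
Proof. by apply: (mulgI (coset H 1)); rewrite -cosetM !mulg1. Qed.

Lemma cosetV (G : groupType) (H : normalSubgroup G) x :
  coset H x^-1 = (coset H x)^-1.
Proof. by apply: (mulgI (coset H x)); rewrite -cosetM !mulgV coset1. Qed.

Lemma coset_image_is_subgroup (G : groupType) (H : normalSubgroup G)
    (A : set G) : is_subgroup A -> is_subgroup (coset H @` A).
Proof.
move=> [A1 AM AV]; split.
- by exists 1 => //; apply: coset1.
- by move=> _ _ [a Aa <-] [b Ab <-]; exists (a * b); [exact: AM|rewrite cosetM].
- by move=> _ [a Aa <-]; exists a^-1; [exact: AV|rewrite cosetV].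
Qed.

Lemma coset_preimage_is_subgroup (G : groupType) (H : normalSubgroup G)
    (B : set (quotient H)) : is_subgroup B -> is_subgroup (coset H @^-1` B).
Proof.
move=> [B1 BM BV]; split=> [|x y Bx By|x Bx] /=.
- by rewrite coset1.
- by rewrite cosetM; apply: BM.
- by rewrite cosetV; apply: BV.
Qed.

Lemma coset_commute (G : groupType) (H : normalSubgroup G) (x y : G) :
  commute (coset H x) (coset H y) <-> normal_set H [~ y, x].
Proof.
have E : (x * y)^-1 * (y * x) = [~ y, x].
  by rewrite invgM commgEl /conjg -!mulgA.
by rewrite -E /commute -!cosetM; split=> [/coset_eqP|Hyx] //; apply/coset_eqP.
Qed.

(** * Setups *)

Section Setup.
Variables (G : groupType) (Z : centralSubgroup G).
Variable delta : quotient Z -> quotient Z -> Z.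

Lemma commutator_central_mod (setup : is_new_setup delta) (a b : G) :
  center (quotient Z) (coset Z [~ a, b]).
Proof.
have [[_ ZM ZV] ZJ] := normal_setP Z.
move=> q; rewrite -(coset_repr q); set z := repr q; apply/coset_commute.
set c := [~ a, b]; set w := b^-1 * a^-1.
(* c measures the difference between the two products of a^-1 and b^-1, which
   are the two conjugators compared by the axiom. *)
have cw : c * w = a^-1 * b^-1.
  by rewrite /c /w /commg /conjg !mulgA mulgK mulgK.
have := new_setup_conj setup b^-1 a^-1 z.
set d1 := lift_delta delta _ _; set d2 := lift_delta delta _ _.
rewrite -/w -cw => E.
have Rw : [~ z, c] ^ w = val d2 * (val d1)^-1.
  by rewrite commgEl conjMg conjVg -conjgM -(mulgK (val d1) (z ^ (c * w)))
             E -mulgA mulKg.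
rewrite -(conjgK w [~ z, c]) Rw.
by apply/ZJ/ZM; [exact: set_valP|apply/ZV; exact: set_valP].
Qed.

Lemma derived_central_mod (setup : is_new_setup delta) (u : G) :
  derived G u -> center (quotient Z) (coset Z u).
Proof.
move: u; apply: derived_min; last exact: commutator_central_mod.
exact/coset_preimage_is_subgroup/center_is_subgroup.
Qed.

(** Multiplying an argument by an element of Z, on either side, does not change
    its coset, so the values of delta on G cannot detect it. *)
Lemma central_sub_Rad : Z `<=` Rad_set delta.
Proof.
apply: Rad_max; first exact: (normal_setP Z).
move=> t Zt.
have tE : coset Z t = 1.
  rewrite -coset1; apply/coset_eqP; rewrite mulg1.
  by have [[_ _ ZV] _] := normal_setP Z; apply: ZV.
by move=> x y; rewrite /lift_delta !cosetM tE !mulg1 !mul1g.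
Qed.

Lemma lift_delta_Rad (x x' y y' : G) :
  Rad_set delta (x^-1 * x') -> Rad_set delta (y^-1 * y') ->
  lift_delta delta x' y' = lift_delta delta x y.
Proof.
move=> /Rad_sub Rx /Rad_sub Ry; rewrite -(mulVKg x x') -(mulVKg y y').
by have [_ -> _ _] := Rx x (y * (y^-1 * y')); have [_ _ _ ->] := Ry x y.
Qed.

End Setup.

Theorem proposition5p1 (G : groupType) (Z : centralSubgroup G)
    (delta : quotient Z -> quotient Z -> Z) (setup : is_new_setup delta) :
  let R : normalSubgroup G := Rad delta in
  let N : set G := mul_set (derived G) R in
  (exists deltaR : quotient R -> quotient R -> Z,
     forall x y : G,
       deltaR (coset R x) (coset R y) = delta (coset Z x) (coset Z y)) /\
  [/\ subgroup_le Z R, subgroup_le R N & is_normal N] /\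
  [/\ subgroup_le Z (center G), is_normal R, subgroup_le (derived G) N
    & subgroup_le (coset R @` N) (center (quotient R))].
Proof.
move=> R N.
have nR : is_normal R := normal_setP R.
have nD := derived_is_normal G.
have nN : is_normal N by apply: mul_set_is_normal.
have ZR : Z `<=` R := central_sub_Rad G Z delta.
split; [|split; split] => //.
- exists (fun a b => lift_delta delta (repr a) (repr b)) => x y.
  rewrite -[RHS]/(lift_delta delta x y).
  by apply/esym/lift_delta_Rad; apply: (coset_reprV R).
- by split=> //; case: (normal_setP Z).
- by split; [case: nR|apply: sub_mul_setr; case: nD].
- exact: central_setP.
- by split; [case: nD|apply: sub_mul_setl; case: nR].
split; first by apply: coset_image_is_subgroup; case: nN.
move=> _ [_ [u Du [r Rr <-]] <-] q.
have -> : coset R (u * r) = coset R u.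
  by apply/esym/coset_eqP; rewrite mulKg.
rewrite -(coset_repr q); apply/coset_commute/ZR/coset_commute.
exact: (derived_central_mod _ _ _ setup u Du).
Qed.
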